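(* Let $G\cong(\underbrace{0,\ldots,0}_{k_1},\underbrace{1,\ldots,1}_{t_1},\underbrace{0,\ldots,0}_{k_2},\underbrace{1,\ldots,1}_{t_2},\ldots,\underbrace{0,\ldots,0}_{k_s},\underbrace{1,\ldots,1}_{t_s})$, with $s\ge 1$ and $k_i,t_i\ge 1$ for all $i$, be a connected threshold graph with $n$ vertices. Then $$q(G)\le\left\lfloor\frac{s+9}{2}\right\rfloor,$$ and consequently $$q(G)\le\frac{n}{4}+C$$ for some constant $C$ independent of $n$ (that is, a single constant $C$ works for all such graphs $G$).
   Context: For a simple graph $G$ on $n$ vertices, $S(G)$ is the set of all real symmetric $n\times n$ matrices $A=(a_{ij})$ such that for $i\neq j$, $a_{ij}\neq 0$ if and only if $ij\in E(G)$ (diagonal entries are unrestricted). $q(A)$ is the number of distinct eigenvalues of $A$ and $q(G)=\min\{q(A): A\in S(G)\}$. The notation $G\cong(b_1,\ldots,b_n)$, with $b_i\in\{0,1\}$ and $b_1=0$, means that $G$ is the threshold graph with creation sequence $(b_1,\ldots,b_n)$: its vertices are $v_1,\ldots,v_n$ and, for $i<j$, $v_i$ and $v_j$ are adjacent if and only if $b_j=1$. *)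

(* Defs.v *)
From HB Require Import structures.
From mathcomp Require Import all_boot all_order all_algebra all_fingroup finmap.
From mathcomp Require Import boolp classical_sets functions cardinality reals.

Set Implicit Arguments.
Unset Strict Implicit.
Unset Printing Implicit Defensive.

Import Order.TTheory GRing.Theory Num.Theory.
Local Open Scope classical_set_scope.
Local Open Scope ring_scope.

(* The vertex set of a graph on n vertices is 'I_n. *)
Record sgraph (n : nat) := SGraph {
  adj :> rel 'I_n;
  adj_sym : symmetric adj;
  adj_irrefl : irreflexive adj
}.

Definition connected_graph (n : nat) (G : sgraph n) : Prop :=
  forall u v : 'I_n, connect G u v.

(* G ~= b: the vertices of G can be listed as v_0, ..., v_(n-1) in such a way
   that, for i < j, v_i and v_j are adjacent iff b_j = 1.  Indices start at 0,
   so that b_1 is [nth false b 0]. *)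
Definition has_creation_seq (n : nat) (G : sgraph n) (b : seq bool) : Prop :=
  [/\ size b = n, nth false b 0 = false &
      exists v : 'S_n, forall i j : 'I_n,
        (i < j)%N -> G (v i) (v j) = nth false b j].

Definition block_seq (s : nat) (k t : 'I_s -> nat) : seq bool :=
  flatten [seq nseq (k i) false ++ nseq (t i) true | i <- enum 'I_s].

Definition SG (R : realType) (n : nat) (G : sgraph n) : set 'M[R]_n :=
  [set A | A^T = A /\ forall i j : 'I_n, i != j -> (A i j != 0) = G i j].

Definition qmx (R : realType) (n : nat) (A : 'M[R]_n) : nat :=
  #|` fset_set [set a : R | eigenvalue A a]|%fset.

(* [fset_set] is only meaningful on finite sets. *)
Lemma finite_eigenvalues (R : realType) (n : nat) (A : 'M[R]_n) :
  finite_set [set a : R | eigenvalue A a].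
Proof.
have nz : char_poly A != 0 by rewrite monic_neq0 // char_poly_monic.
have [s sE] : exists s : seq R, forall a, root (char_poly A) a -> a \in s.
  have [[|c] szc] : exists c, forall s : seq R,
      uniq s -> all (root (char_poly A)) s -> (size s < c)%N.
  - exists (size (char_poly A)) => s us rs; exact: max_poly_roots.
  - by have := szc [::] isT isT.
  elim: c szc => [|c IHc] szc.
    exists [::] => a ra; have := szc [:: a] isT; rewrite /= ra => /(_ isT).
    by [].
  have [[s [us rs szs]]|nos] := pselect (exists s : seq R,
      [/\ uniq s, all (root (char_poly A)) s & size s = c.+1]).
    exists s => a ra; apply/negPn/negP => as_.
    by have := szc (a :: s); rewrite /= as_ us ra rs szs ltnn => /(_ isT isT).
  apply: IHc => s us rs; have := szc s us rs; rewrite ltnS leq_eqVlt.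
  by case/orP => // /eqP sz; case: nos; exists s.
apply: (@sub_finite_set _ _ [set` s]) => // a /=.
by rewrite eigenvalue_root_char => /sE.
Qed.

Lemma ex_qmx (R : realType) (n : nat) (G : sgraph n) :
  exists m : nat, `[< exists2 A : 'M[R]_n, SG G A & qmx A = m >].
Proof.
pose A : 'M[R]_n := \matrix_(i, j) (G i j)%:R.
exists (qmx A); apply/asboolP; exists A => //; split.
  by apply/matrixP => i j; rewrite !mxE adj_sym.
by move=> i j _; rewrite mxE; case: (G i j); rewrite ?oner_eq0 ?eqxx.
Qed.

Definition qG (R : realType) (n : nat) (G : sgraph n) : nat :=
  ex_minn (ex_qmx R G).

(* Main.v *)
(* In fact q(G) <= 4 for every threshold graph. Run through the creation
   sequence keeping a matrix A, a number 0 < th <= 1 and vectors w, u with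
   complementary supports such that A w = th w, A u = 0, and every eigenvector
   of A for an eigenvalue other than 0, 2, -2 is a multiple of w.
   For an isolated vertex, append a zero row and column, and extend u by 1.
   For a dominating vertex, border A with alpha w + beta u, which has no zero
   entry. The bordered matrix agrees with A on the orthogonal complement of w
   and u, and alpha, beta and the corner can be chosen so that the remaining
   eigenvalues are th/2 and elements of {2, -2}, where th/2 has an eigenvector
   without zero entries. This becomes the new w, and the new u is 0. *)

Require Import Defs.
From mathcomp Require Import all_boot all_order all_algebra all_fingroup finmap.
From mathcomp Require Import boolp classical_sets functions cardinality reals.
From mathcomp Require Import ring lra zify.

Set Implicit Arguments.
Unset Strict Implicit.
Unset Printing Implicit Defensive.

Import Order.TTheory GRing.Theory Num.Theory.
Local Open Scope ring_scope.

(** * Dot product of row vectors *)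

Definition dot (R : realType) (n : nat) (x y : 'rV[R]_n) : R :=
  \sum_i x 0 i * y 0 i.

Lemma mul_row_tr (R : realType) (n : nat) (x y : 'rV[R]_n) :
  x *m y^T = (dot x y)%:M.
Proof.
rewrite [LHS]mx11_scalar mxE; congr (_%:M); apply: eq_bigr => i _.
by rewrite !mxE.
Qed.

Lemma dotC (R : realType) (n : nat) (x y : 'rV[R]_n) : dot x y = dot y x.
Proof. by apply: eq_bigr => i _; rewrite mulrC. Qed.

Lemma dotDl (R : realType) (n : nat) (x y z : 'rV[R]_n) :
  dot (x + y) z = dot x z + dot y z.
Proof.
by rewrite -big_split; apply: eq_bigr => i _; rewrite !mxE mulrDl.
Qed.

Lemma dotZl (R : realType) (n : nat) (a : R) (x z : 'rV[R]_n) :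
  dot (a *: x) z = a * dot x z.
Proof. by rewrite mulr_sumr; apply: eq_bigr => i _; rewrite !mxE mulrA. Qed.

Lemma dotDr (R : realType) (n : nat) (x y z : 'rV[R]_n) :
  dot z (x + y) = dot z x + dot z y.
Proof. by rewrite dotC dotDl !(dotC z). Qed.

Lemma dotZr (R : realType) (n : nat) (a : R) (x z : 'rV[R]_n) :
  dot z (a *: x) = a * dot z x.
Proof. by rewrite dotC dotZl (dotC z). Qed.

Lemma dot_ge0 (R : realType) (n : nat) (x : 'rV[R]_n) : 0 <= dot x x.
Proof. by apply: sumr_ge0 => i _; rewrite -expr2 sqr_ge0. Qed.

Lemma dot_eq0 (R : realType) (n : nat) (x : 'rV[R]_n) : dot x x = 0 -> x = 0.
Proof.
move=> /eqP; rewrite psumr_eq0 => [/allP x0|i _]; last first.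
  by rewrite -expr2 sqr_ge0.
apply/rowP => i; rewrite mxE; apply/eqP.
by have := x0 i (mem_index_enum i); rewrite mulf_eq0 orbb.
Qed.

Lemma dot_mulmx (R : realType) (n : nat) (A : 'M[R]_n) (x y : 'rV[R]_n) :
  A^T = A -> dot (x *m A) y = dot x (y *m A).
Proof.
move=> AT; have := mul_row_tr (x *m A) y.
rewrite -mulmxA -{1}AT -trmx_mul mul_row_tr.
by move=> /matrixP /(_ 0 0); rewrite !mxE eqxx !mulr1n.
Qed.

(** * Bordering for a dominating vertex *)

(** [N] and [K] stand for the squared norms of [w] and [u]. The equation in [a] results from
    eliminating the coordinates along [w] and [u] of an eigenvector of the bordered matrix; the
    condition before it is the first coordinate of the eigenvector equation for [th / 2]. *)
Lemma border_params (R : realType) (N K th : R) :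
    0 < N -> 0 <= K -> 0 < th <= 1 ->
  exists alpha beta c : R,
    [/\ alpha != 0, beta != 0,
        - (alpha ^+ 2 * N) + beta ^+ 2 * K + c * (th / 2) = (th / 2) ^+ 2 &
        forall a, a \notin [:: 0; 2; -2] ->
          (a - th) * a * (a - c) = alpha ^+ 2 * N * a + beta ^+ 2 * K * (a - th)
          -> a = th / 2].
Proof.
move=> N0; rewrite le_eqVlt => /orP[/eqP<-|K0] /andP[th0 th1].
  pose r := th * (2 - th) / (2 * N).
  have r0 : 0 < r by rewrite divr_gt0 ?mulr_gt0 //; lra.
  have rN : r * N = th * (2 - th) / 2 by rewrite /r; field; rewrite gt_eqF.
  (* Here [K = 0], so [beta] only has to be nonzero, and the cubic becomes a(a - 2)(a - th/2). *)
  exists (Num.sqrt r), 1, (2 - th / 2).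
  rewrite sqr_sqrtr ?ltW // rN; split; rewrite ?oner_eq0 //.
  - by rewrite sqrtr_eq0 -ltNge.
  - by field.
  move=> a; rewrite !inE !negb_or => /and3P[a0 a2 _] E.
  have : a * (a - 2) * (a - th / 2) = 0 by lra.
  move=> /eqP; rewrite !mulf_eq0 !subr_eq0.
  by rewrite (negPf a0) (negPf a2) => /eqP.
pose r := (4 - th ^+ 2) / (2 * N).
have r0 : 0 < r by rewrite divr_gt0 ?mulr_gt0 //; nra.
have rN : r * N = (4 - th ^+ 2) / 2 by rewrite /r; field; rewrite gt_eqF.
have t0 : 0 < 2 / K by rewrite divr_gt0.
have tK : 2 / K * K = 2 by field; rewrite gt_eqF.
(* These values make the cubic equal to (a - 2)(a + 2)(a - th/2). *)
exists (Num.sqrt r), (Num.sqrt (2 / K)), (- (th / 2)).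
rewrite !sqr_sqrtr ?(ltW r0) ?(ltW t0) // rN tK; split.
- by rewrite sqrtr_eq0 -ltNge.
- by rewrite sqrtr_eq0 -ltNge.
- by field.
move=> a; rewrite !inE !negb_or => /and3P[_ a2 a2'] E.
have : (a - 2) * (a - - 2) * (a - th / 2) = 0 by lra.
by move=> /eqP; rewrite !mulf_eq0 !subr_eq0 (negPf a2) (negPf a2') => /eqP.
Qed.

Definition confined (R : realType) (n : nat) (A : 'M[R]_n) (w : 'rV[R]_n) :=
  forall a x, x *m A = a *: x -> a \notin [:: 0; 2; -2] ->
  exists l, x = l *: w.

(** Complementary supports ensure that a combination of [w] and [u] with nonzero coefficients has no
    zero entry, so it can serve as a border. *)
Definition balanced (R : realType) (n : nat) (A : 'M[R]_n) (th : R)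
    (w u : 'rV[R]_n) : Prop :=
  [/\ A^T = A, w *m A = th *: w, u *m A = 0,
      forall i, (w 0 i == 0) = (u 0 i != 0) & confined A w].

Lemma balanced_dot0 (R : realType) (n : nat) (A : 'M[R]_n) (th : R)
    (w u : 'rV[R]_n) :
  balanced A th w u -> dot w u = 0.
Proof.
case=> _ _ _ wu _; apply: big1 => i _; have := wu i.
by case: eqP => [->|_]; rewrite ?mul0r // => /esym/negbFE/eqP ->; rewrite mulr0.
Qed.

Lemma mul_row_border (R : realType) (n : nat) (A : 'M[R]_n) (v x : 'rV[R]_n)
    (c : R) (y : 'M[R]_1) :
  row_mx y x *m block_mx c%:M v v^T A =
  row_mx (c * y 0 0 + dot x v)%:M (y 0 0 *: v + x *m A).
Proof.
rewrite mul_row_block mul_row_tr [y in LHS]mx11_scalar -scalar_mxM -raddfD /=.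
by rewrite mul_scalar_mx mulrC.
Qed.

(** If (y, x) is an eigenvector for a value outside {0, 2, -2}, then x lies in the span of [w] and
    [u]: the remainder is orthogonal to [w], yet a multiple of [w] by confinement of [A]. What is
    left is the scalar problem of [border_params]. *)
Lemma balanced_border (R : realType) (n : nat) (A : 'M[R]_n) (th : R)
    (w u : 'rV[R]_n) :
    balanced A th w u -> 0 < th <= 1 -> w != 0 ->
  exists (v w' : 'rV[R]_n) (c : R),
    (forall i, v 0 i != 0) /\
    @balanced R (1 + n) (block_mx c%:M v v^T A) (th / 2)
      (row_mx (th / 2)%:M w') 0.
Proof.
move=> bal th01 w0; have wu := balanced_dot0 bal.
have uw : dot u w = 0 by rewrite dotC.
case: bal => AT wA uA supp conf.
have N0 : 0 < dot w w.
  rewrite lt_neqAle dot_ge0 andbT eq_sym; apply: contra w0 => /eqP h.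
  by rewrite (dot_eq0 h).
have [al [be [c [al0 be0 root_th only_th]]]] :=
  border_params N0 (dot_ge0 u) th01.
have th0 : th / 2 != 0 by case/andP: th01 => h _; rewrite gt_eqF ?divr_gt0.
have full e f i : e != 0 -> f != 0 -> (e *: w + f *: u) 0 i != 0.
  move=> e0 f0; rewrite !mxE; have := supp i.
  case: (eqVneq (w 0 i) 0) => [->|wi] /esym ui.
    by rewrite mulr0 add0r mulf_neq0.
  by move/negbFE/eqP: ui => ->; rewrite mulr0 addr0 mulf_neq0.
(* The second vector is the solution x of x(th/2 - A) = (th/2)v, because [w] and [u] have
   eigenvalues [th] and 0. *)
exists (al *: w + be *: u), (- al *: w + be *: u), c; split.
  by move=> i; exact: full.
split.
- by rewrite tr_block_mx tr_scalar_mx trmxK AT.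
- rewrite mul_row_border scale_row_mx mulmxDl -!scalemxAl wA uA scaler0 addr0.
  rewrite mxE eqxx mulr1n !dotDl !dotDr !dotZl !dotZr wu uw; congr row_mx.
    by rewrite scale_scalar_mx; congr (_%:M); rewrite -expr2 -root_th; ring.
  rewrite !scalerDr !scalerA addrAC -scalerDl; congr (_ *: _ + _).
  by field.
- by rewrite mul0mx.
- move=> i; rewrite [X in _ = (X != 0)]mxE eqxx /=; apply/negbTE.
  case: (split_ordP i) => j ->.
    by rewrite row_mxEl mxE ord1 eqxx mulr1n.
  by rewrite row_mxEr full ?oppr_eq0.
move=> a z; rewrite -[z]hsubmxK.
move: (lsubmx z) (rsubmx z) => y' x; rewrite mul_row_border scale_row_mx.
rewrite (mx11_scalar y').
move: (y' 0 0) => y /eq_row_mx[/matrixP/(_ 0 0)].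
rewrite !mxE eqxx !mulr1n => E1 E2 an.
have a0 : a != 0 by move: an; rewrite !inE negb_or => /andP[].
have Nn0 : dot w w != 0 by rewrite gt_eqF.
(* [eta] is read off from the eigenvalue equation, not from a quotient by [dot u u], since [u] may
   be 0. *)
pose xi := dot x w / dot w w; pose eta := be * y / a.
have dxw : dot x w = xi * dot w w by rewrite /xi divfK.
clearbody xi.
have Exi : (a - th) * xi = al * y.
  have := congr1 (fun t => dot t w) E2.
  rewrite /= dotDl !dotZl dotDl !dotZl uw dot_mulmx // wA dotZr dxw => h.
  by apply: (mulIf Nn0); rewrite mulrBl mulrBl -mulrA -h; ring.
have Eeta : a * eta = be * y by rewrite /eta; field.
have dxu : dot x u = eta * dot u u.
  have := congr1 (fun t => dot t u) E2.
  rewrite /= dotDl !dotZl dotDl !dotZl wu dot_mulmx // uA.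
  rewrite -[X in dot x X](scale0r u) dotZr => h.
  by apply: (mulfI a0); rewrite -h mulrA Eeta; ring.
have xE : x = xi *: w + eta *: u.
  (* The border terms cancel, so the remainder satisfies the eigenvalue equation of [A] itself. *)
  have [|l lE] := conf a (x - (xi *: w + eta *: u)) _ an.
    rewrite mulmxBl mulmxDl -!scalemxAl wA uA scaler0 addr0.
    have -> : x *m A = a *: x - y *: (al *: w + be *: u).
      by rewrite -E2 addrC addKr.
    rewrite scalerBr -addrA -opprD; congr (_ - _).
    rewrite !scalerDr !scalerA addrAC -scalerDl Eeta; congr (_ *: _ + _ *: _).
      by rewrite mulrC -Exi; ring.
    by rewrite mulrC.
  have : l * dot w w = 0.
    rewrite -dotZl -lE dotDl -scaleN1r dotZl dotDl !dotZl uw dxw; ring.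
  move=> /eqP; rewrite mulf_eq0 (negPf Nn0) orbF => /eqP l0.
  by apply/eqP; rewrite -subr_eq0 lE l0 scale0r.
rewrite dotDr !dotZr dxw dxu in E1.
(* If the new coordinate vanishes, [E1] forces [xi = 0] and the whole vector is 0. *)
have [y0|y0] := eqVneq y 0.
  have eta0 : eta = 0 by rewrite /eta y0 mulr0 mul0r.
  exists 0; rewrite scale0r xE eta0 y0.
  move: E1; rewrite eta0 y0 !(mulr0, mul0r, add0r, addr0) => /eqP.
  rewrite !mulf_eq0 (negPf al0) (negPf Nn0) orbF /= => /eqP ->.
  by rewrite !scale0r addr0 raddf0 row_mx0.
have aE : a = th / 2.
  apply: only_th => //; apply: (mulIf y0).
  (* Multiplying [E1] by (a - th)a eliminates [xi] and [eta]. *)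
  have -> : (a - th) * a * (a - c) * y = (a - th) * a * (a * y - c * y) by ring.
  rewrite -E1.
  transitivity (al * ((a - th) * xi) * dot w w * a +
                be * (a * eta) * dot u u * (a - th)); first by ring.
  by rewrite Exi Eeta; ring.
clearbody eta; exists (y / (th / 2)); rewrite scale_row_mx scale_scalar_mx divfK // xE.
by congr row_mx; rewrite scalerDr !scalerA; congr (_ *: _ + _ *: _);
  apply: (mulfI th0); rewrite [RHS]mulrA mulrCA divff // mulr1;
  move: Exi Eeta; rewrite aE; lra.
Qed.

(** * Isolated vertices and induction along the creation sequence *)

(** A nonzero eigenvalue forces the new coordinate of its eigenvector to be 0, so confinement is
    inherited. *)
Lemma balanced_isolated (R : realType) (n : nat) (A : 'M[R]_n) (th : R)
    (w u : 'rV[R]_n) :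
    balanced A th w u ->
  @balanced R (1 + n) (block_mx 0 0 0 A) th (row_mx 0 w) (row_mx 1%:M u).
Proof.
case=> AT wA uA supp conf; split.
- by rewrite tr_block_mx !trmx0 AT.
- by rewrite mul_row_block !mulmx0 !add0r wA scale_row_mx scaler0.
- by rewrite mul_row_block !mulmx0 uA !add0r row_mx0.
- move=> i; case: (split_ordP i) => j ->.
    by rewrite !row_mxEl !mxE (ord1 j) !eqxx oner_eq0.
  by rewrite !row_mxEr.
move=> a z; rewrite -[z]hsubmxK.
move: (lsubmx z) (rsubmx z) => y x; rewrite mul_row_block scale_row_mx.
rewrite !mulmx0 !add0r => /eq_row_mx[/esym/eqP y0 xA] an.
have [l ->] := conf a x xA an; exists l.
move: y0; rewrite scaler_eq0.
have -> /= : (a == 0) = false by move: an; rewrite !inE negb_or => /andP[/negPf].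
by move=> /eqP->; rewrite scale_row_mx scaler0.
Qed.

(* Vertices are numbered in reverse order of creation, so that a new vertex
   gets index 0 and the bordered matrix has a type convertible to 'M_n.+2. *)
Lemma threshold_balanced (R : realType) (b : nat -> bool) (n : nat) :
  exists (A : 'M[R]_n.+1) (th : R) (w u : 'rV[R]_n.+1),
    [/\ balanced A th w u, 0 < th <= 1, w != 0 &
        forall i j : 'I_n.+1, (i < j)%N -> (A i j != 0) = b (n - i)%N].
Proof.
elim: n => [|n [A [th [w [u [bal th01 w0 Ab]]]]]].
  exists 1%:M, 1, 1%:M, 0; split=> [|||i j]; last by rewrite !ord1.
  - split; rewrite ?trmx1 ?mulmx1 ?scale1r ?mul0mx //.
      by move=> i; rewrite !mxE !ord1 !eqxx oner_eq0.
    by move=> a x _ _; exists (x 0 0); rewrite scale_scalar_mx mulr1 -mx11_scalar.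
  - by rewrite ltr01 lexx.
  - exact: oner_neq0.
(* Index 0 carries the new bit; an old index i moves to i + 1, which leaves its bit unchanged. *)
have adjE (c : 'M[R]_1) (v : 'rV[R]_n.+1) (d : 'cV[R]_n.+1) :
    (forall j, (v 0 j != 0) = b n.+1) ->
    forall i j : 'I_(1 + n.+1), (i < j)%N ->
      (block_mx c v d A i j != 0) = b (n.+1 - i)%N.
  move=> vb i j; case: (split_ordP i) => i' ->; case: (split_ordP j) => j' ->.
  - by rewrite !ord1.
  - by rewrite block_mxEur ord1 vb subn0.
  - by rewrite ord1.
  by rewrite /= !add1n ltnS block_mxEdr subSS => /Ab.
case b1: (b n.+1).
  have [v [w' [c [v0 bal']]]] := balanced_border bal th01 w0.
  case/andP: th01 => th0 th1.
  exists (block_mx c%:M v v^T A), (th / 2), (row_mx (th / 2)%:M w'), 0.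
  split=> //; first by lra.
    rewrite -(row_mx0 R 1 1 n.+1); apply/eqP => /(@eq_row_mx R 1 1 n.+1)[/rowP/(_ 0)].
    by rewrite !mxE mulr1n => /eqP; rewrite gt_eqF // divr_gt0.
  by apply: adjE => j; rewrite v0 b1.
exists (@block_mx R 1 n.+1 1 n.+1 0 0 0 A), th, (@row_mx R 1 1 n.+1 0 w), (row_mx 1%:M u).
split=> //; first exact: balanced_isolated.
  apply: contra w0; rewrite -(row_mx0 R 1 1 n.+1).
  by move=> /eqP/(@eq_row_mx R 1 1 n.+1)[_ /eqP].
by apply: adjE => j; rewrite mxE eqxx b1.
Qed.

(** * From the matrix to the bound on [qG] *)

Lemma qG_le (R : realType) (n : nat) (G : sgraph n) (A : 'M[R]_n) :
  SG G A -> (qG R G <= qmx A)%N.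
Proof.
by move=> GA; rewrite /qG; case: ex_minnP => m _; apply; apply/asboolP; exists A.
Qed.

Lemma qmx_le (R : realType) (n : nat) (A : 'M[R]_n) (s : seq R) :
  (forall a, eigenvalue A a -> a \in s) -> (qmx A <= size s)%N.
Proof.
move=> As; apply: uniq_leq_size => [|a]; first exact: fset_uniq.
by rewrite in_fset_set ?inE; [exact: As | exact: finite_eigenvalues].
Qed.

(** Outside {0, 2, -2} an eigenvector is a multiple of [w], whose eigenvalue is [th]. *)
Lemma balanced_eigenvalue (R : realType) (n : nat) (A : 'M[R]_n) (th : R)
    (w u : 'rV[R]_n) (a : R) :
  balanced A th w u -> eigenvalue A a -> a \in [:: th; 0; 2; -2].
Proof.
case=> _ wA _ _ conf /eigenvalueP[x xA x0].
rewrite in_cons orbC -implyNb; apply/implyP => an.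
have [l xE] := conf a x xA an.
rewrite -subr_eq0; move: xA => /eqP; rewrite {1}xE -scalemxAl wA scalerA mulrC.
rewrite -scalerA -xE eq_sym -subr_eq0 -scalerBl scaler_eq0 (negPf x0) orbF.
by [].
Qed.

(** The permuted matrix is the conjugate of [A] by [perm_mx s]. *)
Lemma eigenvalue_perm (R : realType) (n : nat) (A : 'M[R]_n) (s : 'S_n) (a : R) :
  eigenvalue (row_perm s (col_perm s A)) a -> eigenvalue A a.
Proof.
move=> /eigenvalueP[x xA x0]; apply/eigenvalueP; exists (x *m perm_mx s).
  rewrite scalemxAl -xA row_permE col_permE -!mulmxA -perm_mxM.
  by rewrite mulVg perm_mx1 mulmx1.
apply: contra x0 => /eqP xs; rewrite -[x]mulmx1 -perm_mx1 -(mulgV s) perm_mxM.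
by rewrite mulmxA xs mul0mx.
Qed.

Lemma threshold_qG_le4 (R : realType) (n : nat) (G : sgraph n) (b : seq bool) :
  has_creation_seq G b -> (qG R G <= 4)%N.
Proof.
case: n G => [|n] G [_ _ [v Gb]].
  apply: leq_trans (@qG_le R 0 G 0 _) _; first by split=> [|[]//]; rewrite trmx0.
  apply: leq_trans (@qmx_le R 0 0 [::] _) _ => // a /eigenvalueP[x _].
  by rewrite thinmx0 eqxx.
have [A [th [w [u [bal _ _ Ab]]]]] := threshold_balanced R (nth false b) n.
(* [s] sends the vertex created at time i to its index in reverse order. *)
pose s : 'S_n.+1 := (v^-1 * perm rev_ord_inj)%g.
have sE i : s (v i) = rev_ord i by rewrite permM permK permE.
apply: leq_trans (@qG_le R _ G (row_perm s (col_perm s A)) _) _; last first.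
  apply: (@qmx_le R _ _ [:: th; 0; 2; -2]) => a /eigenvalue_perm.
  exact: balanced_eigenvalue bal.
have AT : A^T = A by case: bal.
split=> [|i j]; first by apply/matrixP => i j; rewrite !mxE -[in LHS]AT mxE.
rewrite !mxE -(permKV v i) -(permKV v j) !sE; move: (v^-1%g i) (v^-1%g j).
move=> {}i {}j; rewrite (inj_eq perm_inj) neq_ltn => ij.
wlog {ij} ij : i j / (i < j)%N.
  move=> H; case/orP: ij => ij; first exact: H.
  by rewrite -[in LHS]AT mxE adj_sym H.
(* Reversal turns i < j into [rev_ord j < rev_ord i], hence the transpose; the bit read is then that
   of j. *)
rewrite -[A in LHS]AT mxE Gb // Ab /=; first by congr nth; have := ltn_ord j; lia.
by have := ltn_ord j; lia.
Qed.

Theorem theorem12p1 (R : realType) :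
  (forall (n : nat) (G : sgraph n) (s : nat) (k t : 'I_s -> nat),
      (1 <= s)%N ->
      (forall i, 1 <= k i)%N -> (forall i, 1 <= t i)%N ->
      has_creation_seq G (block_seq k t) ->
      connected_graph G ->
      (qG R G <= (s + 9) %/ 2)%N)
  /\
  (exists C : R,
    forall (n : nat) (G : sgraph n) (s : nat) (k t : 'I_s -> nat),
      (1 <= s)%N ->
      (forall i, 1 <= k i)%N -> (forall i, 1 <= t i)%N ->
      has_creation_seq G (block_seq k t) ->
      connected_graph G ->
      (qG R G)%:R <= n%:R / 4%:R + C).
Proof.
split=> [n G s k t _ _ _ /(threshold_qG_le4 R) q4 _|].
  by apply: leq_trans q4 _; rewrite leq_divRL //; lia.
(* [C = 4] suffices because n/4 is nonnegative. *)
exists 4%:R => n G s k t _ _ _ /(threshold_qG_le4 R) q4 _.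
by apply: ler_wpDl; rewrite ?divr_ge0 // ler_nat.
Qed.
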